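(* For every family $\mathcal{O}$ of $n$ (not necessarily distinct) cycles in the complete graph $K_{n+1}$, $\mathcal{O}$ has no rainbow cycle if and only if $\mathcal{O}$ is a saguaro.
   Context: A cycle is regarded as its set of edges; $\bigcup\mathcal{O}$ denotes the union graph. A family means a multiset. Given a family $\mathcal{E}$ of edge sets, an $\mathcal{E}$-rainbow set is a set $R\subseteq\bigcup\mathcal{E}$ with an injection $\sigma:R\to\mathcal{E}$ such that $e\in\sigma(e)$ for all $e\in R$; a rainbow cycle is a rainbow set forming a cycle. Pruned cactus: a family $\mathcal{O}$ of cycles is a pruned cactus if either all cycles in $\mathcal{O}$ are identical to one cycle on $|\mathcal{O}|+1$ vertices, or $\mathcal{O}$ can be partitioned into two pruned cacti $\mathcal{O}_1,\mathcal{O}_2$ such that $\bigcup\mathcal{O}_1$ and $\bigcup\mathcal{O}_2$ share exactly one vertex. Saguaro: a family $\mathcal{O}$ of cycles is a saguaro if $\mathcal{O}$ is a pruned cactus, or $\mathcal{O}$ can be partitioned into three subfamilies $\mathcal{O}_1,\{O\},\mathcal{O}_2$ such that $\mathcal{O}_1,\mathcal{O}_2$ are two vertex-disjoint saguaros and $O$ is an even cycle whose vertices alternate, along $O$, between $V(\bigcup\mathcal{O}_1)$ and $V(\bigcup\mathcal{O}_2)$. *)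

(* Defs.v *)
From mathcomp Require Import all_boot.
Set Implicit Arguments.
Unset Strict Implicit.
Unset Printing Implicit Defensive.

(* A cycle is its set of edges, an edge being a 2-element set of vertices; a
   family (multiset) of cycles is an indexed family [O : I -> {set {set V}}],
   and a subfamily is a set of indices [J : {set I}]. *)

Section Cycles.

Variable V : finType.

Definition cycle_edges (c : seq V) : {set {set V}} :=
  [set [set x; next c x] | x in c].

Definition traverses (c : seq V) (C : {set {set V}}) : Prop :=
  [/\ uniq c, 2 < size c & C = cycle_edges c].

Definition is_cycle (C : {set {set V}}) : Prop := exists c, traverses c C.

Definition alternating_even_cycle (A B : {set V}) (C : {set {set V}}) : Prop :=
  exists c, [/\ traverses c C, ~~ odd (size c) &
    forall x, x \in c ->
      (x \in A /\ next c x \in B) \/ (x \in B /\ next c x \in A)].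

End Cycles.

Section Families.

Variables (V I : finType) (O : I -> {set {set V}}).

(* The injection goes into the index type, so repeated cycles count with
   multiplicity. *)
Definition rainbow_set (R : {set {set V}}) : Prop :=
  R \subset \bigcup_i O i /\
  exists sigma : {e : {set V} | e \in R} -> I,
    injective sigma /\ forall e, val e \in O (sigma e).

Definition rainbow_cycle (R : {set {set V}}) : Prop :=
  rainbow_set R /\ is_cycle R.

Definition union_vertices (J : {set I}) : {set V} :=
  cover (\bigcup_(i in J) O i).

Inductive pruned_cactus : {set I} -> Prop :=
| PrunedCactusCycle (J : {set I}) (C : {set {set V}}) of
    is_cycle C & (forall i, i \in J -> O i = C) & #|cover C| = #|J|.+1 :
    pruned_cactus J
| PrunedCactusGlue (J1 J2 : {set I}) of
    [disjoint J1 & J2] & pruned_cactus J1 & pruned_cactus J2 &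
    #|union_vertices J1 :&: union_vertices J2| = 1 :
    pruned_cactus (J1 :|: J2).

Inductive saguaro : {set I} -> Prop :=
| SaguaroCactus (J : {set I}) of pruned_cactus J : saguaro J
| SaguaroBridge (J1 J2 : {set I}) (i : I) of
    [disjoint J1 & J2] & i \notin J1 :|: J2 &
    saguaro J1 & saguaro J2 &
    [disjoint union_vertices J1 & union_vertices J2] &
    alternating_even_cycle (union_vertices J1) (union_vertices J2) (O i) :
    saguaro (i |: (J1 :|: J2)).

End Families.

(* Main.v *)
Require Import Defs.
From mathcomp Require Import all_boot zify.
Set Implicit Arguments.
Unset Strict Implicit.
Unset Printing Implicit Defensive.

(* Work over GF(2).  A nonempty set of edges with zero boundary contains a
   cycle, so the family has no rainbow cycle iff every nonempty rainbow set has
   nonzero boundary ([rainbow_free]).  For saguaros this is a parity count.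

   Conversely, greedy choice gives a rainbow spanning tree [t j \in O j]; let
   [phi j] be the cut of the tree edge [t j].  Exchanging tree edges shows that
   every edge of [O i] outside the tree crosses [phi i], and that two cycles
   with a common edge outside the tree coincide.  Draw an arc from a cycle [C]
   to a different cycle [O j] when an edge of [C] crosses [phi j].  Around a
   minimal directed cycle the crossing edges would have boundary in the span of
   the remaining tree edges, so the arcs are acyclic and some cycle [C] is a
   source.  If [C] occurs once, it alternates between the two sides of its cut
   and all other cycles lie on one side.  If it occurs at least twice, it
   consists of the tree edges of its copies and one more edge, so a component
   of the remaining forest meets it in exactly one vertex.  Induction applies
   to both parts. *)

Local Notation "\xor_ ( i 'in' A ) F" := (\big[addb/false]_(i in A) F)
  (at level 41, F at level 41, i, A at level 50).
Local Notation "\xor_ ( i ) F" := (\big[addb/false]_i F)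
  (at level 41, F at level 41, i at level 50).

(** * Sums over GF(2) *)

Section Xor.

Variable T : finType.
Implicit Types (A B : {set T}) (F : T -> bool).

Lemma xor_mkcond A F : \xor_(x in A) F x = \xor_(x) ((x \in A) && F x).
Proof. by rewrite big_mkcond; apply: eq_bigr => x _; case: (x \in A). Qed.

Lemma xor_delta (a : T) F : \xor_(x) ((x == a) && F x) = F a.
Proof.
rewrite (bigD1 a) //= eqxx big1 ?addbF // => x /negPf ->.
by [].
Qed.

Definition symdiff A B := [set x | (x \in A) (+) (x \in B)].

Lemma xor_symdiff A B F :
  \xor_(x in symdiff A B) F x = \xor_(x in A) F x (+) \xor_(x in B) F x.
Proof.
rewrite !xor_mkcond -big_split; apply: eq_bigr => x _ /=.
by rewrite inE; case: (x \in A) (x \in B) (F x) => [] [] [].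
Qed.

Lemma symdiff_eq0 A B : symdiff A B = set0 -> A = B.
Proof.
move=> AB0; apply/setP=> x; have := in_set0 x; rewrite -AB0 inE.
by case: (x \in A) (x \in B) => [] [].
Qed.

Lemma xor_exists A F : \xor_(x in A) F x -> exists2 x, x \in A & F x.
Proof.
move=> AF; case: (boolP [exists x in A, F x]) => [/exists_inP // | ].
rewrite negb_exists_in => /forall_inP A0.
by rewrite big1 // in AF => x /A0 /negPf.
Qed.

Lemma xor_another A F a : a \in A -> F a -> \xor_(x in A) F x = false ->
  exists x, [/\ x \in A, x != a & F x].
Proof.
move=> aA Fa; rewrite (big_setD1 a) //= Fa => /negbFE /xor_exists[x].
by rewrite !inE => /andP[xa xA] Fx; exists x.
Qed.

Lemma xor_pair i j F : i != j -> \xor_(x in [set i; j]) F x = F i (+) F j.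
Proof. by move=> ij; rewrite big_setU1 ?big_set1 // inE. Qed.

Lemma xor_all A : \xor_(x in A) true = odd #|A|.
Proof.
rewrite -sum1_card (big_morph odd oddD (erefl : odd 0 = false)).
by apply: eq_bigr.
Qed.

Lemma disjoint_setU A B (D : {set T}) :
  [disjoint A :|: B & D] = [disjoint A & D] && [disjoint B & D].
Proof. by rewrite -!setI_eq0 setIUl setU_eq0. Qed.

End Xor.

(** * Cycles as edge sets *)

Section CycleFacts.

Variable V : finType.
Implicit Types (P e : {set V}) (C X : {set {set V}}) (c : seq V).

(** The GF(2) pairing of two vertex sets, that is, the parity of [P :&: e]; for an edge [e] it tells
    whether [e] crosses the cut of [P]. *)
Definition cross P e := \xor_(x in P) (x \in e).

Lemma crossC P e : cross P e = cross e P.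
Proof. by rewrite /cross !xor_mkcond; apply: eq_bigr => x _; rewrite andbC. Qed.

Lemma cross_pair P (x y : V) : x != y ->
  cross P [set x; y] = (x \in P) (+) (y \in P).
Proof. by move=> xy; rewrite crossC; apply: xor_pair. Qed.

Lemma next_rot_to c x : uniq c -> x \in c ->
  exists s, [/\ uniq (x :: s), size (x :: s) = size c & next c =1 next (x :: s)].
Proof.
move=> Uc xc; have [i s def_c] := rot_to xc; exists s.
by rewrite -def_c rot_uniq size_rot; split => // y; rewrite next_rot.
Qed.

Lemma next_neq c x : uniq c -> 1 < size c -> x \in c -> next c x != x.
Proof.
move=> Uc sc xc; have [[|y s] [Us ss ->]] := next_rot_to Uc xc.
  by rewrite -ss in sc.
by move: Us; rewrite /= eqxx !inE; case: eqVneq => // ->; rewrite eqxx.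
Qed.

Lemma next_next_neq c x : uniq c -> 2 < size c -> x \in c ->
  next c (next c x) != x.
Proof.
move=> Uc sc xc; have [[|y [|z s]] [Us ss e]] := next_rot_to Uc xc;
  rewrite -?ss // in sc *.
rewrite !e; move: Us; rewrite /= eqxx !inE !negb_or.
move=> /andP[/and3P[xy xz _] _].
by rewrite [y == x]eq_sym (negPf xy) eqxx eq_sym.
Qed.

Lemma next_closed c P x y : uniq c ->
  {in c, forall z, z \in P -> next c z \in P} ->
  x \in c -> y \in c -> x \in P -> y \in P.
Proof.
move=> Uc nP xc yc xP.
have := fconnect_cycle (cycle_next Uc) xc y; rewrite yc => /iter_findex <-.
suff: iter (findex (next c) x y) (next c) x \in c /\
      iter (findex (next c) x y) (next c) x \in P by case.
elim: (findex _ _ _) => [|k [IHc IHP]] //=.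
by rewrite mem_next IHc nP.
Qed.

(** Two distinct vertices with the same outgoing edge would be successors of each other, which the
    length bound excludes. *)
Lemma edge_inj c : uniq c -> 2 < size c ->
  {in c &, injective (fun x => [set x; next c x])}.
Proof.
move=> Uc sc x y xc yc exy.
have: x \in [set y; next c y] by rewrite -exy !inE eqxx.
have: y \in [set x; next c x] by rewrite exy !inE eqxx.
rewrite !inE => /orP[/eqP // | /eqP ynx] /orP[/eqP // | /eqP xny].
by have := next_next_neq Uc sc xc; rewrite -ynx -xny eqxx.
Qed.

Lemma cycle_edgeP c C e : traverses c C ->
  reflect (exists2 x, x \in c & e = [set x; next c x]) (e \in C).
Proof. by case=> Uc sc ->; apply: imsetP. Qed.

Lemma edge_pair C e : is_cycle C -> e \in C ->
  exists x y, x != y /\ e = [set x; y].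
Proof.
move=> [c tc] /(cycle_edgeP _ tc)[x xc ->]; exists x, (next c x).
by case: tc => Uc sc _; rewrite eq_sym next_neq // ltnW.
Qed.

Lemma cover_cycle c C : traverses c C -> cover C = [set x in c].
Proof.
move=> tc; apply/setP=> x; rewrite inE; apply/bigcupP/idP => [[e] | xc].
  move=> /(cycle_edgeP _ tc)[y yc ->]; rewrite !inE.
  by case/orP=> /eqP-> //; rewrite mem_next.
by exists [set x; next c x]; rewrite ?set21 //; apply/(cycle_edgeP _ tc); exists x.
Qed.

Lemma card_cycle c C : traverses c C -> #|C| = size c.
Proof.
case=> Uc sc ->; rewrite card_in_imset; last exact: edge_inj.
exact/card_uniqP.
Qed.

Lemma card_cover_cycle C : is_cycle C -> #|cover C| = #|C|.
Proof.
move=> [c tc]; rewrite (card_cycle tc) (cover_cycle tc) cardsE.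
by apply/card_uniqP; case: tc.
Qed.

Lemma cycle_neq0 C : is_cycle C -> C != set0.
Proof.
by move=> [c tc]; rewrite -card_gt0 (card_cycle tc); case: tc => _ /ltnW/ltnW.
Qed.

Lemma next_inj c : uniq c -> injective (next c).
Proof. by move=> Uc; apply: can_inj (prev_next Uc). Qed.

(** Each edge is counted at its start and at its end; reindexing by [next] turns one sum into the
    other, so they cancel. *)
Lemma cycle_even C x : is_cycle C -> \xor_(e in C) (x \in e) = false.
Proof.
move=> [c [Uc sc ->]]; rewrite big_imset /=; last exact: edge_inj.
have -> : \xor_(y in c) (x \in [set y; next c y]) =
          \xor_(y in c) ((x == y) (+) (x == next c y)).
  apply: eq_bigr => y yc; rewrite !inE.
  have := next_neq Uc (ltnW sc) yc; have [<-|] := eqVneq x y => //=.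
  by rewrite eq_sym => /negPf ->.
rewrite big_split (reindex_inj (next_inj Uc)) /=.
by under eq_bigl do rewrite mem_next; rewrite addbb.
Qed.

Lemma cycle_cross_even C P : is_cycle C -> \xor_(e in C) cross P e = false.
Proof.
by move=> cC; rewrite exchange_big big1 //= => x _; rewrite cycle_even.
Qed.

Lemma cycle_connected C P : is_cycle C -> {in C, forall e, ~~ cross P e} ->
  cover C \subset P \/ [disjoint cover C & P].
Proof.
move=> [c tc] CP; rewrite (cover_cycle tc).
have nP : {in c, forall z, (next c z \in P) = (z \in P)}.
  move=> z zc; have /CP : [set z; next c z] \in C.
    by apply/(cycle_edgeP _ tc); exists z.
  rewrite cross_pair; last by case: tc => Uc sc _; rewrite eq_sym next_neq // ltnW.
  by case: (z \in P); case: (next c z \in P).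
have Uc : uniq c by case: tc.
have [/exists_inP[x xc xP]|] := boolP [exists x in c, x \in P].
  left; apply/subsetP=> y; rewrite inE => yc.
  by apply: (next_closed Uc _ xc yc xP) => z zc; rewrite nP.
rewrite negb_exists_in => /forall_inP cP; right.
by rewrite disjoint_subset; apply/subsetP=> y; rewrite inE => /cP.
Qed.

(** Once [X] contains the edge entering a vertex, evenness there forces the edge leaving it, so [X]
    spreads along the whole cycle. *)
Lemma even_sub_cycle C X : is_cycle C -> X \subset C -> X != set0 ->
  (forall x, \xor_(e in X) (x \in e) = false) -> X = C.
Proof.
move=> [c tc] sXC /set0Pn[e0 e0X] X0; apply/eqP; rewrite eqEsubset sXC /=.
have [x0 x0c e0E] := cycle_edgeP _ tc (subsetP sXC _ e0X).
have [Uc sc _] := tc.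
pose Q := [set z | [set z; next c z] \in X].
have x0Q : x0 \in Q by rewrite inE -e0E.
apply/subsetP=> e /(cycle_edgeP _ tc)[y yc ->].
suff: y \in Q by rewrite inE.
apply: (next_closed Uc _ x0c yc x0Q) => z zc; rewrite !inE => zX.
have [|e' [e'X e'n ze']] := xor_another zX _ (X0 (next c z)).
  by rewrite set22.
have [w wc e'E] := cycle_edgeP _ tc (subsetP sXC _ e'X).
move: ze'; rewrite e'E !inE => /orP[/eqP -> | /eqP/(next_inj Uc) zw].
  by rewrite -e'E.
by rewrite e'E zw eqxx in e'n.
Qed.

(** A path in [X] is extended at its head, where evenness supplies a second edge. The path cannot
    outgrow [V], so at some stage the new endpoint already lies on it and closes a cycle. *)
Lemma even_has_cycle X : X != set0 ->
  {in X, forall e, exists x y, x != y /\ e = [set x; y]} ->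
  (forall x, \xor_(e in X) (x \in e) = false) ->
  exists2 C, is_cycle C & C \subset X.
Proof.
move=> X0 edgeX evenX; pose r x y := (x != y) && ([set x; y] \in X).
suff /(_ #|V|)[// | [x [y [p [sp /card_uniqP Us _]]]]] : forall m,
    (exists2 C, is_cycle C & C \subset X) \/
    (exists x y p, [/\ size p = m, uniq [:: x, y & p] & path r x (y :: p)]).
  by have := max_card [in [:: x, y & p]]; rewrite Us /= sp ltnNge leqnSn.
elim=> [|m [|[x [y [p [sp Us rp]]]]]]; [right | by left |].
  have [e eX] := set0Pn _ X0; have [x [y [xy eE]]] := edgeX e eX.
  by exists x, y, [::]; rewrite /= /r !inE xy -eE eX.
have [xy xyX] : x != y /\ [set x; y] \in X by case/andP: rp => /andP[].
have [|e [eX exy xe]] := xor_another xyX _ (evenX x); first by rewrite set21.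
have [z xz eE] : exists2 z, x != z & e = [set x; z].
  have [a [b [ab eE]]] := edgeX e eX; move: xe; rewrite eE !inE.
  case/orP=> /eqP ->; first by exists b.
  by exists a; rewrite 1?eq_sym // setUC.
have zy : z != y by apply: contraNneq exy => <-; rewrite eE.
have rzx : r z x by rewrite /r eq_sym xz setUC -eE.
have [zs | zs] := boolP (z \in [:: x, y & p]); last first.
  by right; exists z, x, (y :: p); rewrite /= -sp; split=> //; [rewrite zs | rewrite rzx].
(* Here [z] lies on the path beyond [y]; the initial segment up to [z], closed by the edge from [z]
   to [x], is the cycle. *)
left; move: zs; rewrite !inE eq_sym (negPf xz) (negPf zy) /= => zp.
move: Us rp; case/splitPr: zp => p1 p2 Us rp.
pose c := [:: x, y & rcons p1 z].
have Uc : uniq c.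
  move: Us; rewrite -cat_rcons -[_ :: _ :: _]/(c ++ p2) cat_uniq.
  by case/andP.
have rc : cycle r c.
  rewrite /= rcons_path last_rcons rzx andbT.
  by move: rp; rewrite /= -cat_rcons cat_path => /and3P[-> ->].
exists (cycle_edges c); first by exists c; split; rewrite //= size_rcons.
by apply/subsetP=> _ /imsetP[w wc ->]; case/andP: (next_cycle rc wc).
Qed.

(** Two steps along the cycle lead from a vertex of [P] to another vertex of [P]. This later keeps
    both families beside a bridge nonempty. *)
Lemma alternating_card_gt1 P (Q : {set V}) C : [disjoint P & Q] ->
  alternating_even_cycle P Q C -> 1 < #|P|.
Proof.
move=> dPQ [c [[Uc sc _] _ alt]].
have dF y : y \in Q -> y \in P -> False by move=> /(disjointFl dPQ) ->.
have [x xc xP] : exists2 x, x \in c & x \in P.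
  case: c sc alt {Uc} => // x c _ alt.
  have xc : x \in x :: c by rewrite inE eqxx.
  have [[xP _] | [_ nP]] := alt x xc; first by exists x.
  by exists (next (x :: c) x); rewrite ?mem_next.
have nc : next c x \in c by rewrite mem_next.
have nnP : next c (next c x) \in P.
  have [[_ nQ] | [xQ _]] := alt x xc; last by case: (dF x).
  by have [[nP _] | [] //] := alt _ nc; case: (dF (next c x)).
apply: leq_trans (subset_leq_card (A := [set x; next c (next c x)]) _).
  by rewrite cards2 eq_sym next_next_neq.
by apply/subsetP=> y /set2P[] ->.
Qed.

End CycleFacts.

(** * Rainbow-free families and saguaros *)

Section RainbowFree.

Variables (V I : finType) (O : I -> {set {set V}}).
Hypothesis cycO : forall i, is_cycle (O i).
Implicit Types (J K L X Y A B : {set I}) (s : I -> {set V}).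

(** A rainbow set encoded from the side of its colours: the inverse of the injection, as a total
    function of which only the values on [K] matter. *)
Definition rainbow_choice K s :=
  {in K &, injective s} /\ {in K, forall i, s i \in O i}.

Definition boundary K s x := \xor_(i in K) (x \in s i).

Definition rainbow_free J := forall K s, K \subset J -> rainbow_choice K s ->
  boundary K s =1 xpred0 -> K = set0.

Lemma rainbow_choiceS K L s : K \subset L -> rainbow_choice L s ->
  rainbow_choice K s.
Proof.
move=> /subsetP sKL [injs Os]; split; first exact: sub_in2 injs.
exact: sub_in1 Os.
Qed.

Lemma boundary_imset K s x : {in K &, injective s} ->
  boundary K s x = \xor_(e in s @: K) (x \in e).
Proof. by move=> injs; rewrite big_imset. Qed.

Lemma rainbow_freeP :
  (~ exists R, rainbow_cycle O R) <-> rainbow_free [set: I].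
Proof.
split=> [noR K s _ [injs Os] bK | freeO [R [[_ [sigma [injsig sigO]]] cR]]].
  apply/eqP; apply: contra_notT noR => K0; have [i0 i0K] := set0Pn _ K0.
  have [||x|C cC /subsetP sCK] := @even_has_cycle _ (s @: K).
  - by apply/set0Pn; exists (s i0); apply: imset_f.
  - by move=> _ /imsetP[i iK ->]; apply: edge_pair (Os i iK).
  - by rewrite -boundary_imset.
  (* The cycle inherits the colours of [s]; the default [i0] is never taken, because every edge of
     [C] is some [s i] with [i \in K]. *)
  pose sigma (e : {e | e \in C}) := odflt i0 [pick i in K | s i == val e].
  have sigmaP e : sigma e \in K /\ s (sigma e) = val e.
    rewrite /sigma; case: pickP => [i /andP[iK /eqP] // | no].
    have /imsetP[i iK ei] := sCK _ (valP e).
    by have := no i; rewrite iK ei eqxx.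
  exists C; split=> //; split.
    apply/subsetP=> e /sCK/imsetP[i iK ->].
    by apply/bigcupP; exists i => //; apply: Os.
  exists sigma; split=> [e e' see | e].
    by apply: val_inj; have [_ <-] := sigmaP e; have [_ <-] := sigmaP e'; rewrite see.
  by have [eK <-] := sigmaP e; apply: Os.
have [e0 e0R] := set0Pn _ (cycle_neq0 cR).
(* [tau] extends [sigma] to all vertex sets, sending those outside [R] to the colour of [e0]; the
   index set of the choice will be [tau @: R]. *)
pose tau e := sigma (insubd (exist _ e0 e0R) e).
have tauO e : e \in R -> e \in O (tau e).
  by move=> eR; have := sigO (insubd (exist _ e0 e0R) e); rewrite insubdK.
have injtau : {in R &, injective tau}.
  move=> e e' eR e'R /injsig /(congr1 val); rewrite /= !insubdK //.
pose s i := odflt set0 [pick e in R | tau e == i].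
have sK e : e \in R -> s (tau e) = e.
  move=> eR; rewrite /s; case: pickP => [e' /andP[e'R /eqP] | /(_ e)].
    exact: injtau.
  by rewrite eR eqxx.
suff : tau @: R = set0 by move/setP/(_ (tau e0)); rewrite in_set0 imset_f.
apply: (freeO _ s) => [||x].
- exact: subsetT.
- split=> [i j /imsetP[e eR ->] /imsetP[e' e'R ->] | i /imsetP[e eR ->]].
    by rewrite !sK // => ->.
  by rewrite sK // tauO.
- rewrite /boundary big_imset //=; apply: etrans (cycle_even x cR).
  by apply: eq_bigr => e eR; rewrite sK.
Qed.

Lemma edge_sub_union J i e : i \in J -> e \in O i ->
  e \subset union_vertices O J.
Proof. by move=> iJ ei; apply: bigcup_sup; apply/bigcupP; exists i. Qed.

Lemma cross_sub (U e : {set V}) i :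
  e \in O i -> e \subset U -> cross U e = false.
Proof.
move=> /(edge_pair (cycO i))[x [y [xy ->]]] /subsetP sU.
by rewrite cross_pair // !sU // !inE eqxx ?orbT.
Qed.

Lemma boundary_sub (U : {set V}) K s x : {in K, forall i, s i \subset U} ->
  boundary K s x -> x \in U.
Proof. by move=> sU /xor_exists[i iK]; apply: subsetP; apply: sU. Qed.

Lemma xor_boundary (P : {set V}) K s :
  \xor_(x in P) boundary K s x = \xor_(i in K) cross P (s i).
Proof. exact: exchange_big. Qed.

Lemma xor_boundary_sub (U : {set V}) K s : rainbow_choice K s ->
  {in K, forall i, s i \subset U} -> \xor_(x in U) boundary K s x = false.
Proof.
move=> [_ Os] sU; rewrite xor_boundary big1 // => i iK.
by rewrite (cross_sub (Os i iK)) // sU.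
Qed.

Lemma boundary_split J1 J2 K s x : [disjoint J1 & J2] -> K \subset J1 :|: J2 ->
  boundary K s x = boundary (K :&: J1) s x (+) boundary (K :&: J2) s x.
Proof.
move=> dJ sK; rewrite {1}/boundary (big_setID J1) /=; congr addb.
apply: eq_bigl => i; rewrite !inE; have := subsetP sK i; rewrite !inE.
case: (boolP (i \in J1)) => [/(disjointFr dJ)-> | _] /=; first by rewrite andbF.
by case: (i \in K) => //= ->.
Qed.

Lemma setI_eq0_split J1 J2 K : K \subset J1 :|: J2 -> K :&: J1 = set0 ->
  K :&: J2 = set0 -> K = set0.
Proof. by move=> /setIidPl def_K K1 K2; rewrite -def_K setIUr K1 K2 setU0. Qed.

(** A nonempty even set of edges of [C] is all of [C], which has one edge more than there are
    colours. *)
Lemma rainbow_free_cycle J C : is_cycle C -> {in J, forall i, O i = C} ->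
  #|cover C| = #|J|.+1 -> rainbow_free J.
Proof.
move=> cC OC cardC K s sKJ [injs Os] bK; apply/eqP; apply: contraT => K0.
have sC : s @: K = C.
  apply: even_sub_cycle => //.
  - apply/subsetP=> _ /imsetP[i iK ->].
    by rewrite -(OC i) ?Os // (subsetP sKJ).
  - by have [i iK] := set0Pn _ K0; apply/set0Pn; exists (s i); apply: imset_f.
  - by move=> x; rewrite -boundary_imset ?bK.
have := subset_leq_card sKJ.
by rewrite -ltnS -cardC card_cover_cycle // -sC card_in_imset // ltnn.
Qed.

(** The two halves of [K] have equal boundaries, supported on the single common vertex. A boundary
    has even size, so both vanish. *)
Lemma rainbow_free_glue J1 J2 : [disjoint J1 & J2] ->
  #|union_vertices O J1 :&: union_vertices O J2| = 1 ->
  rainbow_free J1 -> rainbow_free J2 -> rainbow_free (J1 :|: J2).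
Proof.
move=> dJ /eqP/cards1P[v U12] free1 free2 K s sKJ rK bK.
have rI J : rainbow_choice (K :&: J) s by apply: rainbow_choiceS rK; apply: subsetIl.
have sU J : {in K :&: J, forall i, s i \subset union_vertices O J}.
  move=> i /setIP[iK iJ]; apply: edge_sub_union iJ _.
  by case: rK => _; apply.
have b12 x : boundary (K :&: J1) s x = boundary (K :&: J2) s x.
  by have := bK x; rewrite (boundary_split s x dJ sKJ)
    => /negbT; rewrite negb_add => /eqP.
have b1 x : boundary (K :&: J1) s x = false.
  apply/negP=> bx; have xv y : boundary (K :&: J1) s y -> y = v.
    move=> by1; apply/set1P; rewrite -U12 inE (boundary_sub (sU J1) by1).
    by rewrite b12 in by1; rewrite (boundary_sub (sU J2) by1).
  have [y [_ yx /xv yv]] :=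
    xor_another (boundary_sub (sU J1) bx) bx (xor_boundary_sub (rI J1) (sU J1)).
  by rewrite yv (xv x bx) eqxx in yx.
apply: setI_eq0_split sKJ _ _; [apply: free1 (rI J1) b1 | apply: free2 (rI J2) _].
- exact: subsetIr.
- exact: subsetIr.
- by move=> x; rewrite -b12 b1.
Qed.

Lemma cross_alternating (A B : {set V}) C e : [disjoint A & B] ->
  alternating_even_cycle A B C -> e \in C -> cross A e.
Proof.
move=> dAB [c [tc _ alt]] /(cycle_edgeP _ tc)[x xc ->].
rewrite cross_pair; last by case: tc => Uc sc _; rewrite eq_sym next_neq // ltnW.
have dF y : y \in B -> y \in A = false by apply: disjointFl.
by have [[-> /dF ->] | [/dF -> ->]] := alt x xc.
Qed.

(** Only an edge coloured [i] crosses the cut of [union_vertices O J1], and a zero boundary crosses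
    it evenly, so [i \notin K]. The two halves then have equal boundaries on disjoint vertex
    sets. *)
Lemma rainbow_free_bridge J1 J2 i : [disjoint J1 & J2] -> i \notin J1 :|: J2 ->
  [disjoint union_vertices O J1 & union_vertices O J2] ->
  alternating_even_cycle (union_vertices O J1) (union_vertices O J2) (O i) ->
  rainbow_free J1 -> rainbow_free J2 -> rainbow_free (i |: (J1 :|: J2)).
Proof.
move=> dJ iJ dU alt free1 free2 K s sKJ rK bK.
have rI J : rainbow_choice (K :&: J) s by apply: rainbow_choiceS rK; apply: subsetIl.
have sU J : {in K :&: J, forall i, s i \subset union_vertices O J}.
  move=> k /setIP[kK kJ]; apply: edge_sub_union kJ _.
  by case: rK => _; apply.
have iK : i \notin K.
  apply/negP=> iK; have : \xor_(x in union_vertices O J1) boundary K s x = false.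
    by rewrite big1 // => x _; rewrite bK.
  rewrite xor_boundary (big_setD1 i) //= (cross_alternating dU alt) /=; last first.
    by case: rK => _; apply.
  move/negbFE/xor_exists=> [k /setD1P[ki kK]].
  have kJ : k \in J1 :|: J2.
    by have := subsetP sKJ k kK; rewrite in_setU1 (negPf ki).
  case/setUP: kJ => kJ.
    have sk : s k \subset union_vertices O J1 by apply: sU; rewrite inE kK.
    by case: rK => _ /(_ k kK) /cross_sub -> .
  have sk : s k \subset union_vertices O J2 by apply: sU; rewrite inE kK.
  move=> /xor_exists[x xU] /(subsetP sk); by rewrite (disjointFr dU).
have sK : K \subset J1 :|: J2.
  apply/subsetP=> k kK; have := subsetP sKJ k kK; rewrite in_setU1.
  by case: eqP => // ki; rewrite -ki kK in iK.
have b12 x : boundary (K :&: J1) s x = boundary (K :&: J2) s x.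
  by have := bK x; rewrite (boundary_split s x dJ sK)
    => /negbT; rewrite negb_add => /eqP.
have b1 x : boundary (K :&: J1) s x = false.
  apply/negP=> bx; have := disjointFr dU (boundary_sub (sU J1) bx).
  by rewrite b12 in bx; rewrite (boundary_sub (sU J2) bx).
apply: setI_eq0_split sK _ _; [apply: free1 (rI J1) b1 | apply: free2 (rI J2) _].
- exact: subsetIr.
- exact: subsetIr.
- by move=> x; rewrite -b12 b1.
Qed.

Lemma pruned_cactus_rainbow_free J : pruned_cactus O J -> rainbow_free J.
Proof.
elim=> {J} [J C cC OC cardC | J1 J2 dJ _ f1 _ f2 U12].
  exact: rainbow_free_cycle cC OC cardC.
exact: rainbow_free_glue.
Qed.

Lemma saguaro_rainbow_free J : saguaro O J -> rainbow_free J.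
Proof.
elim=> {J} [J /pruned_cactus_rainbow_free // | J1 J2 i dJ iJ _ f1 _ f2 dU alt].
exact: rainbow_free_bridge.
Qed.

(** * Gluing saguaros at a vertex *)

Lemma union_verticesU J1 J2 :
  union_vertices O (J1 :|: J2) = union_vertices O J1 :|: union_vertices O J2.
Proof. by rewrite /union_vertices bigcup_setU /cover bigcup_setU. Qed.

Lemma alternating_cover (A B : {set V}) C : alternating_even_cycle A B C ->
  cover C \subset A :|: B.
Proof.
move=> [c [tc _ alt]]; rewrite (cover_cycle tc); apply/subsetP=> x.
by rewrite inE => /alt[] [] xA _; rewrite inE xA ?orbT.
Qed.

Lemma alternatingS (A B A' B' : {set V}) C : A \subset A' -> B \subset B' ->
  alternating_even_cycle A B C -> alternating_even_cycle A' B' C.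
Proof.
move=> /subsetP sA /subsetP sB [c [tc oc alt]]; exists c; split=> // x xc.
by have [[xA xB]|[xB xA]] := alt x xc; [left | right]; split; auto.
Qed.

Lemma alternatingC (A B : {set V}) C : alternating_even_cycle A B C ->
  alternating_even_cycle B A C.
Proof.
move=> [c [tc oc alt]]; exists c; split=> // x xc.
by have [|] := alt x xc; [right | left].
Qed.

Lemma union_vertices_bridge J1 J2 i :
  alternating_even_cycle (union_vertices O J1) (union_vertices O J2) (O i) ->
  union_vertices O (i |: (J1 :|: J2)) =
  union_vertices O J1 :|: union_vertices O J2.
Proof.
move=> /alternating_cover alt; rewrite !union_verticesU; apply/setUidPr.
by rewrite /union_vertices big_set1.
Qed.

(** Attaching [X] to the side [A] only enlarges that side and keeps it away from [B], so [O i]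
    remains a bridge. *)
Lemma saguaro_bridge_glue X A B i : saguaro O (X :|: A) -> saguaro O B ->
  [disjoint X & i |: (A :|: B)] -> [disjoint A & B] -> i \notin A :|: B ->
  [disjoint union_vertices O X & union_vertices O B] ->
  [disjoint union_vertices O A & union_vertices O B] ->
  alternating_even_cycle (union_vertices O A) (union_vertices O B) (O i) ->
  saguaro O (X :|: (i |: (A :|: B))).
Proof.
move=> sXA sB; rewrite disjoint_sym disjoint_setU disjoints1.
rewrite disjoint_setU => /and3P[iX dAX dBX] dAB iAB dUX dUA alt.
rewrite setUCA [X :|: (A :|: B)]setUA; apply: SaguaroBridge => //.
- by rewrite disjoint_setU dAB andbT disjoint_sym.
- by move: iAB; rewrite !inE !negb_or => /andP[-> ->]; rewrite iX.
- by rewrite union_verticesU disjoint_setU dUX.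
- by apply: alternatingS alt; rewrite ?union_verticesU ?subsetUr.
Qed.

(** The common vertex lies on exactly one side of the bridge, and [X] is attached to that side. The
    premise quantified over [Y] is shaped to receive the induction hypotheses of [saguaro_glue]. *)
Lemma saguaro_glue_step X A B (i : I) : saguaro O A -> saguaro O B ->
  (forall Y, [disjoint X & Y] ->
    #|union_vertices O X :&: union_vertices O Y| = 1 ->
    Y = A \/ Y = B -> saguaro O (X :|: Y)) ->
  [disjoint X & i |: (A :|: B)] -> [disjoint A & B] -> i \notin A :|: B ->
  [disjoint union_vertices O A & union_vertices O B] ->
  alternating_even_cycle (union_vertices O A) (union_vertices O B) (O i) ->
  #|union_vertices O X :&: union_vertices O (i |: (A :|: B))| = 1 ->
  saguaro O (X :|: (i |: (A :|: B))).
Proof.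
move=> sA sB glue dX dAB iAB dU alt; rewrite union_vertices_bridge //.
move/eqP/cards1P=> [v vU].
have [vX vAB] : v \in union_vertices O X /\
    v \in union_vertices O A :|: union_vertices O B.
  by apply/setIP; rewrite vU set11.
have UXv x : x \in union_vertices O X ->
    (x \in union_vertices O A) || (x \in union_vertices O B) -> x = v.
  by move=> xX xAB; apply/set1P; rewrite -vU inE xX inE.
have dXY Y : Y = A \/ Y = B -> [disjoint X & Y].
  move: dX; rewrite disjoint_sym disjoint_setU disjoints1 disjoint_setU => /and3P[_ dA dB].
  by case=> ->; rewrite disjoint_sym.
have one Y : Y = A \/ Y = B -> v \in union_vertices O Y ->
    #|union_vertices O X :&: union_vertices O Y| = 1.
  move=> YAB vY; apply/eqP/cards1P; exists v; apply/setP=> x.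
  rewrite !inE; apply/andP/eqP => [[xX xY] | ->]; last by split.
  by apply: UXv => //; case: YAB xY => -> ->; rewrite ?orbT.
case/setUP: vAB => [vA | vB].
  apply: saguaro_bridge_glue => //; first by apply: glue; auto.
  rewrite disjoint_subset; apply/subsetP=> x xX; rewrite !inE.
  apply: contraL vA => xB; rewrite -(UXv x xX) ?xB ?orbT //.
  by rewrite (disjointFl dU xB).
rewrite [A :|: B]setUC; apply: saguaro_bridge_glue => //.
- by apply: glue; auto.
- by rewrite [B :|: A]setUC.
- by rewrite disjoint_sym.
- by rewrite setUC.
- rewrite disjoint_subset; apply/subsetP=> x xX; rewrite !inE.
  apply: contraL vB => xA; rewrite -(UXv x xX) ?xA //.
  by rewrite (disjointFr dU xA).
- by rewrite disjoint_sym.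
- exact: alternatingC.
Qed.

(** The definition glues pruned cacti only; a nested induction, on [J1] and then on [J2] when [J1]
    is a cactus, pushes the gluing below all bridges. *)
Lemma saguaro_glue J1 J2 : saguaro O J1 -> saguaro O J2 -> [disjoint J1 & J2] ->
  #|union_vertices O J1 :&: union_vertices O J2| = 1 -> saguaro O (J1 :|: J2).
Proof.
move=> s1; elim: s1 J2 => {J1} [J1 c1 | A B i dAB iAB sA IHA sB IHB dU alt] J2.
  elim=> {J2} [J2 c2 dJ U12 | A B i dAB iAB sA IHA sB IHB dU alt dJ U1].
    by apply: SaguaroCactus; apply: PrunedCactusGlue.
  by apply: saguaro_glue_step => // Y dY U1Y [] eY; subst Y; auto.
move=> s2 dJ U1; rewrite setUC; apply: saguaro_glue_step => //.
- move=> Y; rewrite disjoint_sym setIC [J2 :|: Y]setUC => dY U1Y [] eY; subst Y; auto.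
- by rewrite disjoint_sym.
- by rewrite setIC.
Qed.

End RainbowFree.

(** * Rainbow spanning trees and their cuts *)

(** [K] is a minimal nonempty set in which every element has a predecessor. By minimality every
    choice of predecessors maps [K] onto itself, hence injectively. *)
Lemma predecessor_cycle (T : finType) (r : rel T) (A : {set T}) :
  A != set0 -> {in A, forall x, exists2 y, y \in A & r y x} ->
  exists (K : {set T}) (psi : T -> T),
    [/\ K != set0, K \subset A, {in K, forall x, psi x \in K /\ r (psi x) x},
        {in K &, injective psi} & {in K &, forall x y, r y x -> y = psi x}].
Proof.
move=> A0 srcA.
pose P (K : {set T}) := (K != set0) && [forall x in K, exists y in K, r y x].
have [|K /minsetP[/andP[K0 srcK] minK] sKA] := @minset_exists _ P A.
  rewrite /P A0; apply/forall_inP=> x /srcA[y yA ryx].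
  by apply/exists_inP; exists y.
have onto psi : {in K, forall x, psi x \in K /\ r (psi x) x} -> psi @: K = K.
  move=> psiK; apply: minK.
    apply/andP; split; first by rewrite imset_eq0.
    apply/forall_inP=> _ /imsetP[x xK ->]; have [pK _] := psiK x xK.
    by apply/exists_inP; exists (psi (psi x)); [apply: imset_f | case: (psiK _ pK)].
  by apply/subsetP=> _ /imsetP[x xK ->]; case: (psiK x xK).
pose psi x := odflt x [pick y in K | r y x].
have psiK : {in K, forall x, psi x \in K /\ r (psi x) x}.
  move=> x xK; rewrite /psi; case: pickP => [y /andP[] // | no].
  have /exists_inP[y yK ryx] := forall_inP srcK x xK.
  by have := no y; rewrite /= yK ryx.
have injpsi : {in K &, injective psi} by apply/imset_injP; rewrite onto.
exists K, psi; split=> // x y xK yK ryx; apply/eqP; apply: contraT => y_psi.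
(* Redirecting [x] to a second predecessor [y] would leave [psi x] without a preimage, although
   [psi'] must again be onto. *)
pose psi' z := if z == x then y else psi z.
have : psi' @: K = K.
  by apply: onto => z zK; rewrite /psi'; case: eqP => [-> | _]; auto.
move/setP/(_ (psi x)); rewrite (proj1 (psiK x xK)) => /imsetP[z zK].
rewrite /psi'; case: eqP => [_ exy | zx /(injpsi x z xK zK)/esym //].
by rewrite exy eqxx in y_psi.
Qed.

Section Transversals.

Variables (V I : finType) (O : I -> {set {set V}}).
Hypothesis cycO : forall i, is_cycle (O i).
Implicit Types (J K A B : {set I}) (s t : I -> {set V}) (U : {set V}).

Lemma rainbow_freeS J K : K \subset J -> rainbow_free O J -> rainbow_free O K.
Proof. by move=> sKJ free L s sLK; apply: free; apply: subset_trans sLK sKJ. Qed.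

(** Greedy choice: if the chosen edges covered all of [O j], then [O j] itself would be rainbow in
    their colours. *)
Lemma rainbow_transversal J :
  rainbow_free O J -> exists t, rainbow_choice O J t.
Proof.
move: {2}#|J| (leqnn #|J|) => m; elim: m J => [|m IHm] J.
  by rewrite leqn0 cards_eq0 => /eqP-> _; exists (fun _ => set0); split=> i; rewrite inE.
have [-> _ _|] := eqVneq J set0.
  by exists (fun _ => set0); split=> i; rewrite inE.
case/set0Pn=> j jJ; rewrite (cardsD1 j) jJ ltnS => /IHm IH free.
have [|t [injt Ot]] := IH; first by apply: rainbow_freeS free; apply: subsetDl.
have [e eOj et] : exists2 e, e \in O j & e \notin t @: (J :\ j).
  apply/exists_inP; apply: contraT; rewrite negb_exists_in => /forall_inP sO.
  pose K := [set k in J :\ j | t k \in O j].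
  have sKJ : K \subset J :\ j by apply/subsetP=> k; rewrite inE => /andP[].
  have rK : rainbow_choice O K t by apply: rainbow_choiceS sKJ (conj injt Ot).
  have OK : t @: K = O j.
    apply/setP=> e; apply/imsetP/idP => [[k]| eO].
      by rewrite inE => /andP[_ tk] ->.
    have /imsetP[k kJ ek] := negbNE (sO e eO).
    by exists k; rewrite // inE kJ -ek.
  have K0 : K = set0.
    apply: free (rK) _; first exact: subset_trans sKJ (subsetDl _ _).
    by move=> x; rewrite boundary_imset ?OK ?cycle_even //; case: rK.
  by have := cycle_neq0 (cycO j); rewrite -OK K0 imset0 eqxx.
exists (fun i => if i == j then e else t i); split=> [i k iJ kJ | i iJ] /=.
  case: eqP => [->|/eqP ij]; case: eqP => [->|/eqP kj] //; last first.
  - by apply: injt; rewrite !inE ?ij ?kj.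
  - by move=> tie; rewrite -tie imset_f ?inE ?ij in et.
  - by move=> etk; rewrite etk imset_f ?inE ?kj in et.
by case: eqP => [->|/eqP ij] //; apply: Ot; rewrite !inE ij.
Qed.

Lemma boundary_inj J t A B : rainbow_free O J -> rainbow_choice O J t ->
  A \subset J -> B \subset J -> boundary A t =1 boundary B t -> A = B.
Proof.
move=> free rt sA sB eAB; apply: symdiff_eq0.
have sJ : symdiff A B \subset J.
  apply/subsetP=> i; rewrite inE; have := subsetP sA i; have := subsetP sB i.
  by case: (i \in A) (i \in B) => [] [] // iB iA _; auto.
apply: free sJ (rainbow_choiceS sJ rt) _ => x.
by rewrite /boundary xor_symdiff -![\xor_(i in _) _]/(boundary _ _ _) eAB addbb.
Qed.

(** The total parity over [U] recovers the value at the omitted vertex [u]. *)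
Lemma even_ext U u (w w' : V -> bool) : u \in U ->
  {in ~: U, w =1 w'} -> \xor_(x in U) w x = \xor_(x in U) w' x ->
  {in U :\ u, w =1 w'} -> w =1 w'.
Proof.
move=> uU offU; rewrite !(big_setD1 u uU) /= => tot onU x.
have [xU | xU] := boolP (x \in U); last by apply: offU; rewrite inE.
have [-> | xu] := eqVneq x u; last by apply: onU; rewrite !inE xu.
by move: tot; rewrite (eq_bigr _ onU) => /addIb.
Qed.

(** * Independence, span and dual cuts of a rainbow forest *)

Section Tree.

Variables (J : {set I}) (U : {set V}) (t : I -> {set V}).
Hypotheses (free : rainbow_free O J) (rt : rainbow_choice O J t).
Hypothesis tU : {in J, forall j, t j \subset U}.

Lemma boundary_offU K s x : {in K, forall i, s i \subset U} -> x \in ~: U ->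
  boundary K s x = false.
Proof.
by move=> sU; rewrite inE => xU; apply: contraNF xU => /(boundary_sub sU).
Qed.

Lemma boundary_restrict_inj u : u \in U ->
  {in powerset J &, injective (fun A => [set x in U :\ u | boundary A t x])}.
Proof.
move=> uU A B; rewrite !inE => sA sB eAB; apply: (boundary_inj free rt) => //.
have sAU : {in A, forall j, t j \subset U} by move=> j /(subsetP sA)/tU.
have sBU : {in B, forall j, t j \subset U} by move=> j /(subsetP sB)/tU.
apply: (even_ext uU) => [x xU | | x xU].
- by rewrite !boundary_offU.
- by rewrite !(xor_boundary_sub cycO _ _) //; apply: rainbow_choiceS rt.
- by have /setP/(_ x) := eAB; rewrite !(inE, in_setD1) -in_setD1 xU.
Qed.

(** A forest has fewer edges than vertices. Linear independence is used as counting: distinct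
    subsets of [J] have distinct boundaries on [U :\ u], so [2 ^ #|J|] is at most
    [2 ^ (#|U| - 1)]. *)
Lemma transversal_rank : U != set0 -> #|J| < #|U|.
Proof.
case/set0Pn=> u uU; rewrite (cardsD1 u) uU ltnS -(leq_exp2l (m := 2)) //.
rewrite -!card_powerset -(card_in_imset (boundary_restrict_inj uU)).
apply/subset_leq_card/subsetP=> _ /imsetP[A _ ->]; rewrite inE.
by apply/subsetP=> x; rewrite inE => /andP[].
Qed.

(** With equality in the count, the injection from subsets of [J] to subsets of [U :\ u] is onto:
    the tree spans all even vertex sets. *)
Lemma transversal_span (w : V -> bool) : #|U| = #|J|.+1 ->
  {in ~: U, w =1 xpred0} -> \xor_(x in U) w x = false ->
  exists2 A : {set I}, A \subset J & boundary A t =1 w.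
Proof.
move=> cardU offU even_w.
have /set0Pn[u uU] : U != set0 by rewrite -card_gt0 cardU.
pose F A := [set x in U :\ u | boundary A t x].
have onto : F @: powerset J = powerset (U :\ u).
  apply/eqP; rewrite eqEcard card_in_imset; last exact: boundary_restrict_inj.
  rewrite !card_powerset leq_exp2l //.
  have -> : #|U :\ u| = #|J| by have := cardsD1 u U; rewrite uU cardU => -[].
  rewrite leqnn andbT; apply/subsetP=> _ /imsetP[A _ ->]; rewrite inE.
  by apply/subsetP=> x; rewrite inE => /andP[].
have : [set x in U :\ u | w x] \in F @: powerset J.
  by rewrite onto inE; apply/subsetP=> x; rewrite inE => /andP[].
case/imsetP=> A; rewrite inE => sA eA; exists A => //.
have sAU : {in A, forall j, t j \subset U} by move=> j /(subsetP sA)/tU.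
apply: (even_ext uU) => [x xU | | x xU].
- by rewrite boundary_offU // offU.
- by rewrite even_w (xor_boundary_sub cycO _ _) //; apply: rainbow_choiceS rt.
- by have /setP/(_ x) := eA; rewrite !(inE, in_setD1) -in_setD1 xU.
Qed.

(** [A x] is the tree path from the root [u] to [x], and [phi j] collects the vertices whose path
    uses [t j]. The paths to the two ends of [t k] differ exactly in [k]. *)
Lemma dual_cuts : #|U| = #|J|.+1 -> exists phi : I -> {set V},
  {in J &, forall j k, cross (phi j) (t k) = (j == k)}.
Proof.
move=> cardU; have /set0Pn[u uU] : U != set0 by rewrite -card_gt0 cardU.
have /fin_all_exists[A AP] : forall x, exists A : {set I}, x \in U ->
    A \subset J /\ boundary A t =1 (fun z => (z == u) (+) (z == x)).
  move=> x; have [xU | _] := boolP (x \in U); last by exists set0.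
  have [z | | A sA bA] := @transversal_span (fun z => (z == u) (+) (z == x)) cardU.
  - rewrite inE => zU.
    have no y : y \in U -> (z == y) = false by move=> yU; apply: contraNF zU => /eqP->.
    by rewrite /= !no.
  - rewrite big_split /= (bigD1 u) //= eqxx big1 => [|z /andP[_ /negPf] //].
    by rewrite (bigD1 x) //= eqxx big1 => [|z /andP[_ /negPf] //].
  by exists A.
exists (fun j => [set x in U | j \in A x]) => j k jJ kJ.
have [x [y [xy tk]]] := edge_pair (cycO k) (proj2 rt k kJ).
have [xU yU] : x \in U /\ y \in U.
  by have /subsetP sU := tU kJ; split; apply: sU; rewrite tk !inE eqxx ?orbT.
have [[sAx bAx] [sAy bAy]] := (AP x xU, AP y yU).
have sJ : symdiff (A x) (A y) \subset J.
  apply/subsetP=> i; rewrite inE; have := subsetP sAx i; have := subsetP sAy i.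
  by case: (i \in A x) (i \in A y) => [] [] // iB iA _; auto.
have Axy : symdiff (A x) (A y) = [set k].
  apply: boundary_inj (free) rt sJ _ _; first by rewrite sub1set.
  move=> z; rewrite /boundary xor_symdiff big_set1.
  rewrite -![\xor_(i in A _) _]/(boundary _ _ _) bAx bAy tk !inE.
  have [-> | _] := eqVneq z x; first by rewrite (negPf xy); case: (x == u).
  by case: (z == u) (z == y) => [] [].
rewrite tk cross_pair // !inE xU yU /=.
by have /setP/(_ j) := Axy; rewrite !inE.
Qed.

End Tree.

Lemma rainbow_free_rank J U : rainbow_free O J ->
  {in J, forall j, cover (O j) \subset U} -> U != set0 -> #|J| < #|U|.
Proof.
move=> free OU; have [t rt] := rainbow_transversal free.
apply: (transversal_rank free rt) => j jJ.
by apply: subset_trans (OU j jJ); apply: bigcup_sup; apply: (proj2 rt).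
Qed.

(** The rank bound, applied to the union of the cycles in place of [U], already demands [#|U|]
    vertices. *)
Lemma union_vertices_full J U : J != set0 -> rainbow_free O J ->
  {in J, forall j, cover (O j) \subset U} -> #|U| = #|J|.+1 ->
  union_vertices O J = U.
Proof.
move=> /set0Pn[j jJ] free OU cardU; apply/eqP; rewrite eqEcard cardU.
have sub k : k \in J -> cover (O k) \subset union_vertices O J.
  by move=> kJ; apply/bigcupsP=> e eO; apply: edge_sub_union kJ eO.
apply/andP; split.
  apply/bigcupsP=> e /bigcupP[k kJ eO].
  by apply: subset_trans (OU k kJ); apply: bigcup_sup.
apply: rainbow_free_rank => //; apply: contra_neq (cycle_neq0 (cycO j)) => U0.
have := sub j jJ; rewrite U0 subset0 -cards_eq0 card_cover_cycle // => /eqP.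
exact: cards0_eq.
Qed.

End Transversals.

(** * Exchanging tree edges *)

Section Exchange.

Variables (V I : finType) (O : I -> {set {set V}}).
Hypothesis cycO : forall i, is_cycle (O i).

Variables (J : {set I}) (U : {set V}) (t : I -> {set V}) (phi : I -> {set V}).
Hypotheses (free : rainbow_free O J) (rt : rainbow_choice O J t).
Hypothesis OU : {in J, forall j, cover (O j) \subset U}.
Hypothesis cardU : #|U| = #|J|.+1.
Hypothesis dual : {in J &, forall j k, cross (phi j) (t k) = (j == k)}.
Implicit Types (A K : {set I}) (s : I -> {set V}).

Let T := t @: J.

Lemma edge_sub j e : j \in J -> e \in O j -> e \subset U.
Proof. by move=> jJ ej; apply: subset_trans (OU jJ); apply: bigcup_sup. Qed.

Lemma choice_edge_sub : {in J, forall j, t j \subset U}.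
Proof. by move=> j jJ; apply: edge_sub (proj2 rt j jJ). Qed.

Lemma dual_boundary A j : A \subset J -> j \in J ->
  \xor_(x in phi j) boundary A t x = (j \in A).
Proof.
move=> sA jJ; rewrite xor_boundary.
rewrite (eq_bigr (fun k => k == j)) => [|k kA]; last first.
  by rewrite dual ?(subsetP sA k kA) // eq_sym.
rewrite xor_mkcond -[RHS](xor_delta j (fun k => k \in A)).
by apply: eq_bigr => k _; rewrite andbC.
Qed.

(** The boundary of the new edges is that of some tree edges [A]. The cuts [phi j] with [j \in K]
    are crossed evenly, so [A] avoids [K], and the new edges together with [A] form a rainbow set
    with zero boundary. *)
Lemma exchange K s : K \subset J -> rainbow_choice O K s ->
  {in K, forall i, s i \notin t @: (J :\: K)} ->
  {in K, forall j, \xor_(i in K) cross (phi j) (s i) = false} -> K = set0.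
Proof.
move=> sKJ rK sT crossK; have [injs Os] := rK.
have sU : {in K, forall i, s i \subset U}.
  by move=> i iK; apply: edge_sub (Os i iK); apply: (subsetP sKJ).
have [x xU | | A sA bA] :=
    transversal_span (w := boundary K s) cycO free rt choice_edge_sub cardU.
- by rewrite (boundary_offU sU).
- by rewrite (xor_boundary_sub cycO rK).
have KA j : j \in A -> j \notin K.
  move=> jA; apply: contraL (jA) => jK; rewrite -(dual_boundary sA) ?(subsetP sA) //.
  by under eq_bigr do rewrite bA; rewrite xor_boundary crossK.
pose s' i := if i \in K then s i else t i.
suff /eqP : K :|: A = set0 by rewrite setU_eq0 => /andP[/eqP].
apply: (free (s := s')); first by rewrite subUset sKJ.
  have [injt Ot] := rt.
  have mixed i j : i \in K -> j \in A -> j \notin K -> s i <> t j.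
    move=> iK jA jK sij; case/negP: (sT i iK); rewrite sij imset_f // inE jK.
    exact: (subsetP sA).
  split=> [i j | i]; rewrite !in_setU /s'.
    case: ifP => iK; case: ifP => jK //= iA jA; first exact: injs.
    - by move/mixed; case=> //; rewrite jK.
    - by move/esym/mixed; case=> //; rewrite iK.
    - by apply: injt; apply: (subsetP sA).
  by case: ifP => [/Os //|_] /= iA; apply: Ot; apply: (subsetP sA).
have -> : K :|: A = symdiff K A.
  apply/setP=> j; rewrite !inE; have := KA j.
  by case: (j \in A) => [/(_ isT)/negPf-> | _]; case: (j \in K).
move=> x; rewrite /boundary xor_symdiff.
rewrite (eq_bigr (fun i => x \in s i)) => [|i iK]; last by rewrite /s' iK.
rewrite [X in _ (+) X](eq_bigr (fun i => x \in t i)) => [|i /KA iK]; last first.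
  by rewrite /s' (negPf iK).
by rewrite -![\xor_(i in _) _]/(boundary _ _ _) bA addbb.
Qed.

Lemma notin_transversal e A : A \subset J -> e \notin T -> e \notin t @: A.
Proof. by move=> sA; apply: contra => /(subsetP (imsetS _ sA)). Qed.

(** Otherwise [f] could replace [t i] and violate [exchange]. *)
Lemma cross_own i f : i \in J -> f \in O i -> f \notin T -> cross (phi i) f.
Proof.
move=> iJ fO fT; apply: contraT => /negPf no.
have := @exchange [set i] (fun _ => f); rewrite sub1set iJ => /(_ isT) H.
suff /setP/(_ i) : [set i] = set0 by rewrite !inE eqxx.
apply: H.
- by split=> [k l /set1P-> /set1P-> | k /set1P->].
- by move=> _ _; apply: notin_transversal fT; apply: subsetDl.
- by move=> _ /set1P->; rewrite big_set1.
Qed.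

Lemma exchange2 i j g h : i \in J -> j \in J -> i != j ->
  g \in O i -> h \in O j -> g != h ->
  g \notin t @: (J :\: [set i; j]) -> h \notin t @: (J :\: [set i; j]) ->
  cross (phi i) g = cross (phi i) h -> cross (phi j) g = cross (phi j) h ->
  False.
Proof.
move=> iJ jJ ij gO hO gh gT hT ci cj.
pose s k := if k == i then g else h.
have si : s i = g by rewrite /s eqxx.
have sj : s j = h by rewrite /s eq_sym (negPf ij).
suff /setP/(_ i) : [set i; j] = set0 by rewrite !inE eqxx.
apply: (exchange (s := s)).
- by rewrite subUset !sub1set iJ.
- split=> [k l /set2P[]-> /set2P[]-> // | k /set2P[]->]; rewrite ?si ?sj //.
    by move=> e; rewrite e eqxx in gh.
  by move=> e; rewrite e eqxx in gh.
- by move=> k /set2P[]->; rewrite ?si ?sj.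
- by move=> k /set2P[]->; rewrite xor_pair // si sj ?ci ?cj addbb.
Qed.

Lemma outside i : i \in J -> exists2 f, f \in O i & f \notin T.
Proof.
move=> iJ; apply/exists_inP; apply: contraT; rewrite negb_exists_in.
move=> /forall_inP sO; pose A := [set k in J | t k \in O i].
have sA : A \subset J by apply/subsetP=> k; rewrite inE => /andP[].
have rA := rainbow_choiceS sA rt.
have tA : t @: A = O i.
  apply/setP=> e; apply/imsetP/idP => [[k]| eO].
    by rewrite inE => /andP[_ tk] ->.
  have /imsetP[k kJ ek] := negbNE (sO e eO).
  by exists k; rewrite // inE kJ -ek.
have A0 : A = set0.
  by apply: free sA (rA) _ => x; rewrite boundary_imset ?tA ?cycle_even //; case: rA.
by have := cycle_neq0 (cycO i); rewrite -tA A0 imset0 eqxx.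
Qed.

Lemma cross_transversal j e : j \in J -> e \in T -> cross (phi j) e -> e = t j.
Proof. by move=> jJ /imsetP[k kJ ->]; rewrite dual // => /eqP->. Qed.

(** Two exchanges are played against each other: the first shows that a further edge [g] of [O i]
    cannot cross [phi j], the second shows that it must. *)
Lemma common_edge_unique i j f : i \in J -> j \in J -> i != j ->
  f \in O i -> f \in O j -> f \notin T ->
  {in O i, forall g, g \notin T -> g = f}.
Proof.
have sJ k l : J :\: [set k; l] \subset J by apply: subsetDl.
suff no_cross k l g : k \in J -> l \in J -> k != l -> f \in O k -> f \in O l ->
    f \notin T -> g \in O k -> g \notin T -> g != f -> cross (phi l) g = false.
  move=> iJ jJ ij fi fj fT g gi gT; apply/eqP; apply: contraT => gf.
  (* [O j] crosses [phi i] at [f], hence once more by parity; the second crossing edge can only be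
     [t i], which may therefore be coloured [j] while [g] is coloured [i]. *)
  have tij : t i \in O j.
    have [e [ej ef ce]] := xor_another fj (cross_own iJ fi fT)
      (cycle_cross_even (phi i) (cycO j)).
    have [eT | eT] := boolP (e \in T); first by rewrite -(cross_transversal iJ eT ce).
    by rewrite (no_cross j i e) // 1?eq_sym in ce.
  case: (@exchange2 i j g (t i)) => //.
  - by apply: contraNneq gT => ->; apply: imset_f.
  - exact: notin_transversal gT.
  - apply/imsetP=> -[k]; rewrite !inE negb_or => /andP[/andP[ki _] kJ].
    by move/(proj1 rt)=> eik; rewrite eik ?eqxx in ki.
  - by rewrite (cross_own iJ gi gT) dual ?eqxx.
  - by rewrite (no_cross i j g) // dual // eq_sym (negPf ij).
move=> kJ lJ kl fk fl fT gk gT gf; apply/negP=> cg.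
case: (@exchange2 k l g f) => //; try exact: notin_transversal.
  by rewrite !cross_own.
by rewrite cg cross_own.
Qed.

(** Both cycles have [f] as their only edge outside the tree, so both are the fundamental cycle of
    [f]; parity across each [phi m] matches their tree edges. *)
Lemma common_edge_eq i j f : i \in J -> j \in J ->
  f \in O i -> f \in O j -> f \notin T -> O i = O j.
Proof.
move=> iJ jJ fi fj fT; have [-> // | ij] := eqVneq i j.
suff sub k l : k \in J -> l \in J -> k != l -> f \in O k -> f \in O l -> O k \subset O l.
  by apply/eqP; rewrite eqEsubset !sub // eq_sym.
move=> {i j iJ jJ fi fj ij} iJ jJ ij fi fj.
have uniq_i := common_edge_unique iJ jJ ij fi fj fT.
have uniq_j : {in O l, forall g, g \notin T -> g = f}.
  by apply: common_edge_unique fj fi fT; rewrite // eq_sym.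
apply/subsetP=> g gi; have [gT | /(uniq_i g gi)-> //] := boolP (g \in T).
have /imsetP[m mJ gm] := gT.
have [|e [ei eg ce]] := xor_another gi _ (cycle_cross_even (phi m) (cycO k)).
  by rewrite gm dual ?eqxx.
have ef : e = f.
  apply: uniq_i => //; apply: contra eg => eT.
  by rewrite (cross_transversal mJ eT ce) gm.
rewrite ef in ce.
have [h [hj hf ch]] := xor_another fj ce (cycle_cross_even (phi m) (cycO l)).
have hT : h \in T by apply: contraNT hf => /(uniq_j h hj)->.
by rewrite gm -(cross_transversal mJ hT ch).
Qed.

(** Arcs join edge sets rather than indices, so that all copies of a cycle form one node. *)
Definition cycle_arc (C D : {set {set V}}) :=
  (C != D) && [exists f in C, exists j in J, (O j == D) && cross (phi j) f].

(** By parity a cycle crossing [phi j] does so twice, and at most one crossing edge is in the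
    tree. *)
Lemma cycle_arcP C D : C \in O @: J -> cycle_arc C D ->
  exists p : {set V} * I,
    [/\ p.1 \in C, p.1 \notin T, p.2 \in J, O p.2 = D & cross (phi p.2) p.1].
Proof.
case/imsetP=> i iJ -> /andP[_ /exists_inP[f fi /exists_inP[j jJ /andP[/eqP Oj cf]]]].
have [fT | fT] := boolP (f \in T); last by exists (f, j).
have [e [ei ef ce]] := xor_another fi cf (cycle_cross_even (phi j) (cycO i)).
exists (e, j); split=> //=; apply: contra ef => eT.
by rewrite (cross_transversal jJ eT ce) (cross_transversal jJ fT cf).
Qed.

Lemma source_cycle : J != set0 ->
  exists2 C, C \in O @: J & {in O @: J, forall D, ~~ cycle_arc D C}.
Proof.
case/set0Pn=> j0 j0J.
case: (boolP [exists C in O @: J, forall D in O @: J, ~~ cycle_arc D C]).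
  by case/exists_inP=> C CJ /forall_inP CD; exists C.
rewrite negb_exists_in => /forall_inP noC.
have [||K [psi [K0 sK psiK injpsi psi_uniq]]] := @predecessor_cycle _ cycle_arc (O @: J).
- by apply/set0Pn; exists (O j0); apply: imset_f.
- move=> C /noC; rewrite negb_forall_in => /exists_inP[D DJ].
  by rewrite negbK => DC; exists D.
have /fin_all_exists[p pP] C : exists p : {set V} * I, C \in K ->
    [/\ p.1 \in psi C, p.1 \notin T, p.2 \in J, O p.2 = C & cross (phi p.2) p.1].
  case: (boolP (C \in K)) => [CK | _]; last by exists (set0, j0).
  have [pK ar] := psiK C CK; have [p pp] := cycle_arcP (subsetP sK _ pK) ar.
  by exists p.
pose f C := (p C).1; pose j C := (p C).2.
have onto : psi @: K = K.
  apply/eqP; rewrite eqEcard card_in_imset // leqnn andbT.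
  by apply/subsetP=> _ /imsetP[C /psiK[pK _] ->].
have /fin_all_exists[rho rhoP] C : exists D, C \in K -> D \in K /\ psi D = C.
  case: (boolP (C \in K)) => [| _]; last by exists C.
  by rewrite -{1}onto => /imsetP[D DK ->]; exists D.
have Oj C : C \in K -> O (j C) = C by move=> /pP[].
have jJ C : C \in K -> j C \in J by move=> /pP[].
have injj : {in K &, injective j} by move=> C D CK DK e; rewrite -(Oj C) // e Oj.
have fT C : C \in K -> f C \notin T by move=> /pP[].
have fpsi C : C \in K -> f C \in O (j (psi C)).
  by move=> CK; rewrite Oj; [case: (pP C CK) | case: (psiK C CK)].
(* Any further crossing would be an arc from [psi E] to [D], forcing [psi E = psi D] by uniqueness
   of predecessors. *)
have crossE D E : D \in K -> E \in K ->
    cross (phi (j D)) (f E) = (D == E) (+) (D == psi E).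
  move=> DK EK; have [pEK /andP[pEE _]] := psiK E EK.
  have [-> | DE] := eqVneq D E.
    by rewrite eq_sym (negPf pEE); case: (pP E EK).
  have [-> | DpE] := eqVneq D (psi E); first by rewrite cross_own ?fpsi ?fT ?jJ.
  apply: contraNF DE => cDE; apply/eqP; apply: injpsi => //.
  apply/esym; apply: psi_uniq => //; rewrite /cycle_arc eq_sym DpE /=.
  apply/exists_inP; exists (f E); first by rewrite -(Oj (psi E)) ?fpsi.
  by apply/exists_inP; exists (j D); rewrite ?jJ ?Oj ?eqxx.
(* [f (rho C)] lies on [psi (rho C) = C], so [j C] is a valid colour for it. Each [phi (j D)] is
   crossed by exactly two of these edges, [f D] and [f (rho D)], which contradicts [exchange]. *)
pose s i := f (rho (O i)).
have sj C : C \in K -> s (j C) = f (rho C) by move=> CK; rewrite /s Oj.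
suff /eqP : j @: K = set0 by rewrite imset_eq0 (negPf K0).
apply: (exchange (s := s)).
- by apply/subsetP=> _ /imsetP[C CK ->]; apply: jJ.
- split=> [_ _ /imsetP[C CK ->] /imsetP[D DK ->] | _ /imsetP[C CK ->]].
    rewrite !sj // => efCD; have [[CK' pC] [DK' pD]] := (rhoP C CK, rhoP D DK).
    suff: O (j C) = O (j D) by rewrite !Oj // => ->.
    apply: (common_edge_eq (f := f (rho C))); rewrite ?jJ ?fT //.
      by rewrite -{2}pC fpsi.
    by rewrite efCD -{2}pD fpsi.
  by have [CK' pC] := rhoP C CK; rewrite sj // -{2}pC fpsi.
- move=> _ /imsetP[C CK ->]; rewrite sj //; have [CK' _] := rhoP C CK.
  by apply: notin_transversal (fT _ CK'); apply: subsetDl.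
move=> _ /imsetP[D DK ->]; rewrite big_imset //=.
have [pDK _] := psiK D DK.
rewrite (eq_bigr (fun C => (C == psi D) (+) (C == D))) => [|C CK]; last first.
  have [CK' pC] := rhoP C CK; rewrite sj // crossE // pC [D == C]eq_sym.
  congr addb; apply/eqP/eqP => [-> // | epD].
  by apply: injpsi; rewrite // -epD.
have one E : E \in K -> \xor_(C in K) (C == E).
  by move=> EK; rewrite (bigD1 E) //= eqxx big1 => [|C /andP[_ /negPf]].
by rewrite big_split /= !one.
Qed.

(** * Splitting a family at a source cycle *)

Section SourceClass.

Variables (C : {set {set V}}) (i : I).
Hypotheses (iJ : i \in J) (OiC : C = O i).
Hypothesis srcC : {in O @: J, forall D, ~~ cycle_arc D C}.

Let K := [set k in J | O k == C].

Let cC : is_cycle C. Proof. by rewrite OiC. Qed.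

Let iK : i \in K. Proof. by rewrite inE iJ OiC eqxx. Qed.

Let sKJ : K \subset J. Proof. by apply/subsetP=> k; rewrite inE => /andP[]. Qed.

Let OK k : k \in K -> O k = C. Proof. by rewrite inE => /andP[_ /eqP]. Qed.

Lemma source_no_cross j k f : j \in J :\: K -> k \in K -> f \in O j ->
  cross (phi k) f = false.
Proof.
rewrite !inE => /andP[jK jJ] /andP[kJ Ok] fj; apply/negP=> cf.
case/negP: (srcC (imset_f O jJ)); rewrite jJ /= in jK; rewrite /cycle_arc jK /=.
by apply/exists_inP; exists f => //; apply/exists_inP; exists k; rewrite ?Ok.
Qed.

(* If [f] were the tree edge of another cycle [O k], then colouring [f] by a
   copy of [C] would free [k] for an edge of [O k] outside the tree. *)
Lemma source_cross f : f \in C -> exists2 k, k \in K & cross (phi k) f.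
Proof.
move=> fC; have [/imsetP[k kJ fk] | fT] := boolP (f \in t @: J); last first.
  exists i => //; apply: (cross_own iJ _ fT).
  by rewrite -OiC.
have [kK | kK] := boolP (k \in K); first by exists k; rewrite // fk dual ?eqxx.
have [g gk gT] := outside kJ.
have ik : i != k by apply: contraNneq kK => <-.
have kJK : k \in J :\: K by rewrite inE kK.
exfalso; apply: (@exchange2 i k f g) => //.
- by rewrite -OiC.
- by apply: contraNneq gT => <-; rewrite fk imset_f.
- rewrite fk; apply/imsetP=> -[l]; rewrite !inE negb_or => /andP[/andP[_ lk] lJ].
  by move/(proj1 rt)=> e; rewrite e ?eqxx in lk.
- by apply: contra gT => /(subsetP (imsetS _ (subsetDl _ _))).
- by rewrite (source_no_cross kJK iK gk) // fk dual // (negPf ik).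
- by rewrite fk dual // eqxx (cross_own kJ gk gT).
Qed.

(** Every edge of [C] crosses [phi i], so [C] alternates; no edge of another cycle does, so by
    connectedness each of these stays on one side. *)
Lemma source_bridge : #|K| <= 1 -> exists (P Q : {set V}) (J1 J2 : {set I}),
  [/\ J = i |: (J1 :|: J2), [disjoint J1 & J2], i \notin J1 :|: J2,
      [disjoint P & Q] & alternating_even_cycle P Q (O i)] /\
  [/\ {in J1, forall j, cover (O j) \subset P},
      {in J2, forall j, cover (O j) \subset Q},
      #|P| = #|J1|.+1 & #|Q| = #|J2|.+1].
Proof.
move=> K1.
have {}K1 : K = [set i] by apply/esym/eqP; rewrite eqEcard sub1set iK cards1.
have crossP f : f \in C -> cross (phi i) f.
  by move=> /source_cross[k]; rewrite K1 => /set1P->.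
pose side (X : {set V}) := [set j in J :\ i | cover (O j) \subset X].
pose P := U :&: phi i; pose Q := U :\: phi i.
have dPQ : [disjoint P & Q].
  rewrite disjoint_subset; apply/subsetP=> x; rewrite !inE.
  by case/andP=> -> ->.
have UPQ : P :|: Q = U by rewrite setID.
have alt : alternating_even_cycle P Q C.
  have [c tc] := cC; exists c; split=> //.
    rewrite -(card_cycle tc) -xor_all.
    by rewrite -(eq_bigr _ crossP) cycle_cross_even.
  have [Uc sc _] := tc.
  have xU x : x \in c -> x \in U.
    move=> xc; apply: (subsetP (OU iJ)).
    by rewrite -OiC (cover_cycle tc) inE.
  move=> x xc; have /crossP : [set x; next c x] \in C.
    by apply/(cycle_edgeP _ tc); exists x.
  rewrite cross_pair; last by rewrite eq_sym next_neq // ltnW.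
  rewrite !inE !xU ?mem_next //.
  by case: (x \in phi i) => /= [/negPf-> | ->]; [left | right].
have sideJ : J = i |: (side P :|: side Q).
  apply/setP=> j; rewrite !inE; case: eqVneq => [-> // | ji] /=.
  rewrite -andb_orr; case jJ: (j \in J) => //=; apply/esym.
  have jJK : j \in J :\: K by rewrite K1 !inE ji.
  have [|sP|dP] := @cycle_connected _ (O j) (phi i) (cycO j).
  - by move=> f fj; rewrite (source_no_cross jJK).
  - by rewrite [_ \subset P]subsetI sP OU.
  - by rewrite [_ \subset Q]subsetD OU // dP orbT.
have dS : [disjoint side P & side Q].
  rewrite disjoint_subset; apply/subsetP=> j; rewrite !inE.
  move=> /andP[-> sP] /=; apply/negP=> sQ.
  have := card_cover_cycle (cycO j).
  suff -> : cover (O j) = set0.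
    by rewrite cards0 => /esym/cards0_eq/eqP; apply/negP/cycle_neq0.
  apply/eqP; rewrite -subset0; move: dPQ; rewrite -setI_eq0 => /eqP <-.
  by rewrite subsetI sP.
have iS : i \notin side P :|: side Q by rewrite !inE eqxx.
have sS X : side X \subset J by apply/subsetP=> j; rewrite !inE => /andP[/andP[]].
have fS X : rainbow_free O (side X) := rainbow_freeS (sS X) free.
have OS X : {in side X, forall j, cover (O j) \subset X}.
  by move=> j; rewrite inE => /andP[].
have gP := alternating_card_gt1 dPQ alt.
have gQ : 1 < #|Q|.
  by apply: alternating_card_gt1 (alternatingC alt); rewrite disjoint_sym.
have rk (X : {set V}) : 1 < #|X| -> #|side X| < #|X|.
  by move=> gX; apply: rainbow_free_rank => //; rewrite -card_gt0 ltnW.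
(* The rank bounds on the two sides add up to exactly [#|U|], so both are tight. *)
have cS : #|P| = #|side P|.+1 /\ #|Q| = #|side Q|.+1.
  have := rk P gP; have := rk Q gQ.
  have : #|P| + #|Q| = (#|side P| + #|side Q|).+2.
    rewrite -(cardsUI P Q) -(cardsUI (side P)); move: dPQ dS.
    rewrite -!setI_eq0 => /eqP-> /eqP->.
    by rewrite !cards0 !addn0 UPQ cardU {1}sideJ cardsU1 iS.
  by lia.
have [cP cQ] := cS.
exists P, Q, (side P), (side Q); rewrite -OiC; do 2!split=> //; exact: OS.
Qed.

(** A second copy of [C] makes [f] its only edge outside the tree, and [source_cross] shows that its
    tree edges belong to copies of [C]. *)
Lemma card_cover_source : 1 < #|K| -> #|cover C| = #|K|.+1.
Proof.
move=> K1.
have [f fC fT] := outside iJ; rewrite -OiC in fC.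
have [j jK ij] : exists2 j, j \in K & i != j.
  have : 0 < #|K :\ i| by move: K1; rewrite (cardsD1 i) iK.
  by case/card_gt0P=> j /setD1P[ji jK]; exists j; rewrite // eq_sym.
have CE : C = f |: t @: K.
  apply/setP=> e; rewrite in_setU1; apply/idP/orP => [eC | [/eqP-> // | ]].
    have [eT | eT] := boolP (e \in t @: J).
      have [k kK ce] := source_cross eC.
      rewrite (cross_transversal _ eT ce) ?imset_f ?(subsetP sKJ) //.
      by right.
    left; apply/eqP; have jJ := subsetP sKJ j jK.
    apply: (common_edge_unique iJ jJ ij) eT; rewrite -?OiC //.
    by rewrite OK.
  by case/imsetP=> k kK ->; rewrite -(OK kK) (proj2 rt) // (subsetP sKJ).
rewrite card_cover_cycle // CE cardsU1 card_in_imset; last first.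
  by move=> a b /(subsetP sKJ) aJ /(subsetP sKJ) bJ; apply: (proj1 rt).
by rewrite (contra _ fT) // => /(subsetP (imsetS _ sKJ)).
Qed.

Lemma source_glue : 1 < #|K| -> J != K ->
  exists (W U2 : {set V}) (J1 J2 : {set I}),
  [/\ J1 :|: J2 = J, [disjoint J1 & J2], 0 < #|J1|, 0 < #|J2| &
      #|W :&: U2| = 1] /\
  [/\ {in J1, forall j, cover (O j) \subset W},
      {in J2, forall j, cover (O j) \subset U2},
      #|W| = #|J1|.+1 & #|U2| = #|J2|.+1].
Proof.
move=> K1 JK; have cardC := card_cover_source K1.
have [j0 j0J] : exists j0, j0 \in J :\: K.
  apply/set0Pn; rewrite setD_eq0; apply: contra JK => sJK.
  by rewrite eqEsubset sJK.
have [z zO] : exists z, z \in cover (O j0).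
  apply/set0Pn; rewrite -card_gt0 card_cover_cycle // card_gt0.
  exact: cycle_neq0.
(* The component of [z] in the forest left after deleting the tree edges of all copies of [C],
   described through their cuts. *)
pose W := [set x in U | [forall k in K, (x \in phi k) == (z \in phi k)]].
have sWU : W \subset U by apply/subsetP=> x; rewrite inE => /andP[].
have zW : z \in W.
  rewrite inE; apply/andP; split; last by apply/forall_inP.
  by apply: (subsetP (OU (x := j0) _)) => //; move: j0J; rewrite inE => /andP[].
have W_or j' : j' \in J :\: K -> cover (O j') \subset W \/ [disjoint cover (O j') & W].
  move=> jJK; apply: cycle_connected => // e eO.
  have jJ : j' \in J by move: jJK; rewrite inE => /andP[].
  have sU := edge_sub jJ eO.
  have [x [y [xy def_e]]] := edge_pair (cycO j') eO.
  have noc k : k \in K -> (x \in phi k) = (y \in phi k).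
    move=> kK; have := source_no_cross jJK kK eO; rewrite def_e cross_pair //.
    by move/negbT; rewrite negb_add => /eqP.
  rewrite def_e cross_pair // negb_add !inE.
  rewrite !(subsetP sU) ?def_e ?set21 ?set22 //=.
  by apply/eqP; apply: eq_forallb_in => k kK; rewrite noc.
pose J1 := [set j' in J :\: K | cover (O j') \subset W]; pose J2 := J :\: J1.
have sJ1 : J1 \subset J by apply/subsetP=> k; rewrite !inE => /andP[/andP[]].
have sJ2 : J2 \subset J by apply: subsetDl.
have j0J1 : j0 \in J1.
  rewrite inE j0J; have [// | d] := W_or j0 j0J.
  by rewrite (disjointFr d zO) in zW.
have iJ2 : i \in J2 by rewrite in_setD iJ andbT inE in_setD iK.
pose X := cover C :&: W; pose U2 := (U :\: W) :|: X.
(* The tree edges of the copies span the vertices of [C], so two vertices of [C] in [W] would be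
   joined by a path of such edges; yet none of the cuts [phi k] separates them, so the path is
   empty. *)
have cardX : #|X| <= 1.
  apply/card_le1_eqP=> x y /setIP[xC xW] /setIP[yC yW]; apply/eqP.
  apply: contraT; rewrite eq_sym => xy.
  have [|||a aC||A sA bA] := @transversal_span _ _ O cycO K (cover C) t _ _ _
    (fun a => a \in [set x; y]) cardC.
  - exact: rainbow_freeS free.
  - exact: rainbow_choiceS rt.
  - by move=> k kK; apply: bigcup_sup; rewrite -(OK kK) (proj2 rt) // (subsetP sKJ).
  - rewrite inE in aC; rewrite !inE /=; apply: contraNF aC.
    by case/orP=> /eqP->.
  - by rewrite -/(cross (cover C) [set x; y]) cross_pair // xC yC.
  have A0 : A = set0.
    apply/eqP; rewrite -subset0; apply/subsetP=> k kA.
    have kK := subsetP sA k kA; have kJ := subsetP sKJ k kK.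
    rewrite -(dual_boundary (subset_trans sA sKJ) kJ) in kA.
    move: kA; under eq_bigr do rewrite bA; rewrite -/(cross (phi k) [set x; y]) cross_pair //.
    move: xW yW; rewrite !inE => /andP[_ /forall_inP/(_ k kK)/eqP->].
    by case/andP=> _ /forall_inP/(_ k kK)/eqP->; rewrite addbb.
  by have := bA x; rewrite A0 /boundary big_set0 set21.
have OJ1 : {in J1, forall k, cover (O k) \subset W} by move=> k; rewrite inE => /andP[].
have OJ2 : {in J2, forall k, cover (O k) \subset U2}.
  move=> k; rewrite in_setD => /andP[kJ1 kJ]; have [kK | kK] := boolP (k \in K).
    apply/subsetP=> x xO; have xU := subsetP (OU kJ) x xO.
    by rewrite OK // in xO; rewrite in_setU in_setD in_setI xU xO; case: (x \in W).
  have kJK : k \in J :\: K by rewrite inE kK.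
  have [sW | dW] := W_or k kJK; first by rewrite inE kJK sW in kJ1.
  by apply: subset_trans (subsetUl _ _); rewrite subsetD OU.
have free1 := rainbow_freeS sJ1 free; have free2 := rainbow_freeS sJ2 free.
have cJ : #|J1| + #|J2| = #|J| by rewrite -(cardsID J1 J) (setIidPr sJ1).
have cU2 : #|U2| = #|U :\: W| + #|X|.
  rewrite cardsU; suff -> : (U :\: W) :&: X = set0 by rewrite cards0 subn0.
  by apply/setP=> x; rewrite in_setI in_setD in_setI in_set0;
    case: (x \in W); rewrite ?andbF.
have cU : #|W| + #|U :\: W| = #|U| by rewrite -(cardsID W U) (setIidPr sWU).
have r1 : #|J1| < #|W|.
  by apply: rainbow_free_rank => //; apply/set0Pn; exists z.
have r2 : #|J2| < #|U2|.
  apply: rainbow_free_rank => //; apply/set0Pn.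
  have [x xC] : exists x, x \in cover C by apply/set0Pn; rewrite -card_gt0 cardC.
  by exists x; apply: (subsetP (OJ2 i iJ2)); rewrite -OiC.
(* The two rank bounds require [#|J| + 2] vertices counted with overlap, while only
   [#|J| + 1 + #|X|] are available. Hence [X] is a single vertex and both bounds are tight. *)
have [c1 c2 cX] : [/\ #|W| = #|J1|.+1, #|U2| = #|J2|.+1 & #|X| = 1].
  move: r1 r2 cJ cU cU2 cardX cardU.
  move: #|W| #|U2| #|X| #|J1| #|J2| #|J| #|U| #|U :\: W|; clear=> *.
  by split; lia.
exists W, U2, J1, J2; split; split=> //.
- by rewrite -[RHS](setID J J1) (setIidPr sJ1).
- by rewrite disjoint_sym disjoints_subset subsetDr.
- by apply/card_gt0P; exists j0.
- by apply/card_gt0P; exists i.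
rewrite -cX; congr #|pred_of_set _|; apply/setP=> x.
rewrite in_setI in_setU in_setD in_setI.
by case: (x \in W); rewrite ?andbF.
Qed.

End SourceClass.

End Exchange.

(** * From rainbow-free families to saguaros *)

Section Main.

Variables (V I : finType) (O : I -> {set {set V}}).
Hypothesis cycO : forall i, is_cycle (O i).
Implicit Types (J : {set I}) (U : {set V}).

(** The tightness [#|U| = #|J|.+1], which makes the tree span [U], passes to both parts of either
    splitting, so the induction carries [U] along. *)
Lemma rainbow_free_saguaro J U : J != set0 -> rainbow_free O J ->
  {in J, forall j, cover (O j) \subset U} -> #|U| = #|J|.+1 -> saguaro O J.
Proof.
move: {2}#|J| (leqnn #|J|) => m; elim: m J U => [|m IHm] J U.
  by rewrite leqn0 cards_eq0 => ->.
move=> leJm J0 free OU cardU.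
have [t rt] := rainbow_transversal cycO free.
have [phi dual] := dual_cuts cycO free rt (choice_edge_sub rt OU) cardU.
have [C /imsetP[i iJ OiC] srcC] := source_cycle cycO free rt OU cardU dual J0.
have fS (L : {set I}) : L \subset J -> rainbow_free O L.
  by move=> sLJ; apply: rainbow_freeS sLJ free.
have [K1 | K1] := leqP #|[set k in J | O k == C]| 1.
  have [P [Q [J1 [J2 [[defJ dJ iJ12 dPQ alt] [OJ1 OJ2 c1 c2]]]]]] :=
    source_bridge cycO free rt OU cardU dual iJ OiC srcC K1.
  have gP := alternating_card_gt1 dPQ alt.
  have gQ : 1 < #|Q|.
    by apply: alternating_card_gt1 (alternatingC alt); rewrite disjoint_sym.
  have cJ : #|J| = (#|J1| + #|J2|).+1.
    rewrite defJ cardsU1 iJ12 cardsU; move: dJ; rewrite -setI_eq0 => /eqP->.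
    by rewrite cards0 subn0.
  have [sJ1 sJ2] : J1 \subset J /\ J2 \subset J.
    by rewrite defJ; split; apply: subset_trans (subsetUr _ _);
      rewrite ?subsetUl ?subsetUr.
  have [J10 J20] : J1 != set0 /\ J2 != set0 by split; rewrite -card_gt0; lia.
  have U1 := union_vertices_full cycO J10 (fS _ sJ1) OJ1 c1.
  have U2 := union_vertices_full cycO J20 (fS _ sJ2) OJ2 c2.
  rewrite defJ; apply: SaguaroBridge; rewrite ?U1 ?U2 //.
    by apply: IHm (fS _ sJ1) OJ1 c1; lia.
  by apply: IHm (fS _ sJ2) OJ2 c2; lia.
have [JK | JK] := eqVneq J [set k in J | O k == C].
  apply: SaguaroCactus; apply: (@PrunedCactusCycle _ _ _ _ C).
  - by rewrite OiC.
  - by move=> k; rewrite JK inE => /andP[_ /eqP].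
  - by rewrite [in RHS]JK (card_cover_source cycO free rt OU cardU dual iJ).
have [P [Q [J1 [J2 [[defJ dJ J10 J20 cPQ] [OJ1 OJ2 c1 c2]]]]]] :=
  source_glue cycO free rt OU cardU dual iJ OiC srcC K1 JK.
have cJ : #|J| = #|J1| + #|J2|.
  by rewrite -defJ cardsU; move: dJ; rewrite -setI_eq0 => /eqP->; rewrite cards0 subn0.
have [sJ1 sJ2] : J1 \subset J /\ J2 \subset J by rewrite -defJ subsetUl subsetUr.
rewrite card_gt0 in J10 *; rewrite card_gt0 in J20 *.
rewrite -defJ; apply: saguaro_glue => //.
- by apply: IHm (fS _ sJ1) OJ1 c1 => //; rewrite -card_gt0 in J20; lia.
- by apply: IHm (fS _ sJ2) OJ2 c2 => //; rewrite -card_gt0 in J10; lia.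
rewrite (union_vertices_full cycO J10 (fS _ sJ1) OJ1 c1).
by rewrite (union_vertices_full cycO J20 (fS _ sJ2) OJ2 c2).
Qed.

End Main.

Theorem theorem3p4 (n : nat) (n_gt0 : 0 < n)
    (O : 'I_n -> {set {set 'I_n.+1}}) (cycO : forall i : 'I_n, is_cycle (O i)) :
  (~ exists R : {set {set 'I_n.+1}}, rainbow_cycle O R) <->
  saguaro O [set: 'I_n].
Proof.
split=> [/(rainbow_freeP cycO) free | /(saguaro_rainbow_free cycO)].
  (* The [n] cycles on [n.+1] vertices are tight for the whole vertex set. *)
  apply: (rainbow_free_saguaro cycO (U := setT)) => //.
  - by rewrite -card_gt0 cardsT card_ord.
  - by rewrite !cardsT !card_ord.
by move/(rainbow_freeP cycO).
Qed.
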